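(* Let $\alpha>0$, $\beta>0$, $\mu\in\mathbb{R}$, $\sigma>0$, $s>0$. Let $U$ be a random variable with the beta distribution with parameters $\alpha$ and $\beta$ on $[0,1]$, and define $$ X=\begin{cases} \mu-\sigma\left[F_\Gamma^{-1}(1-2U)\right]^{1/s}, & U\in[0,1/2],\\ \mu+\sigma\left[F_\Gamma^{-1}(2U-1)\right]^{1/s}, & U\in(1/2,1], \end{cases} $$ where $F_\Gamma^{-1}$ is the quantile function of the gamma distribution with shape parameter $1/s$ and scale parameter $1$. Then $X$ has the $\mathrm{BGN}(\alpha,\beta,\mu,\sigma,s)$ distribution.
   Context: For $s>0$, let $\phi_s(z)=\frac{s}{2\Gamma(1/s)}\exp(-|z|^s)$, $z\in\mathbb{R}$, be the standardized generalized normal density, and let $\Phi_s$ be its cumulative distribution function: $\Phi_s(z)=\frac{\Gamma(1/s,(-z)^s)}{2\Gamma(1/s)}$ for $z\le 0$ and $\Phi_s(z)=1-\frac{\Gamma(1/s,z^s)}{2\Gamma(1/s)}$ for $z>0$, where $\Gamma(a,x)=\int_x^\infty t^{a-1}e^{-t}\,\mathrm{d}t$ is the complementary incomplete gamma function and $\Gamma(\cdot)$ is the gamma function. Let $\mathrm{B}(\alpha,\beta)=\Gamma(\alpha)\Gamma(\beta)/\Gamma(\alpha+\beta)$ be the beta function. A random variable $X$ has the beta generalized normal distribution $\mathrm{BGN}(\alpha,\beta,\mu,\sigma,s)$, with $\alpha,\beta,\sigma,s>0$ and $\mu\in\mathbb{R}$, if its cumulative distribution function is $$ F(x)=\frac{1}{\mathrm{B}(\alpha,\beta)}\int_0^{\Phi_s\left(\frac{x-\mu}{\sigma}\right)}t^{\alpha-1}(1-t)^{\beta-1}\,\mathrm{d}t,\quad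 x\in\mathbb{R}. $$ The events $U=0$ and $U=1$, where the quantile function is evaluated at $1$, have probability zero. *)

(* Defs.v *)
From HB Require Import structures.
From mathcomp Require Import all_boot all_order all_algebra.
From mathcomp Require Import all_classical all_reals all_analysis.

Set Implicit Arguments.
Unset Strict Implicit.
Unset Printing Implicit Defensive.

Import Order.TTheory GRing.Theory Num.Theory.
Import numFieldNormedType.Exports.

Local Open Scope classical_set_scope.
Local Open Scope ring_scope.

Section special_functions.
Context {R : realType}.
Implicit Types a b : R.

Definition Gamma a : R :=
  \int[lebesgue_measure]_(t in `]0, +oo[) (t `^ (a - 1) * expR (- t)).

Definition Beta a b : R := Gamma a * Gamma b / Gamma (a + b).

End special_functions.

Section gamma_distribution.
Context {R : realType}.
Implicit Types a p x : R.

(* Gamma distribution with shape a and scale 1; the value is 0 for x < 0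
   because `[0, x] is then empty. *)
Definition gamma_cdf a x : R :=
  (\int[lebesgue_measure]_(t in `[0, x]) (t `^ (a - 1) * expR (- t))) / Gamma a.

(* Generalized inverse of gamma_cdf on the support [0, +oo[ of the
   distribution, so that the quantile at 0 is 0. For 1 <= p the set is empty
   and inf returns 0 instead of +oo. *)
Definition gamma_quantile a p : R :=
  inf [set x : R | 0 <= x /\ p <= gamma_cdf a x].

End gamma_distribution.

Section beta_distribution.
Context {R : realType}.
Implicit Types a b t : R.

(* The library's beta_pdf and beta_prob only allow natural number parameters. *)
Definition beta_density a b t : R :=
  if 0 <= t <= 1 then t `^ (a - 1) * (1 - t) `^ (b - 1) / Beta a b else 0.

Definition beta_distributed d (T : measurableType d) (P : probability T R)
    (U : {RV P >-> R}) a b : Prop :=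
  forall A : set R, measurable A ->
    distribution P U A =
    (\int[lebesgue_measure]_(t in A) (beta_density a b t)%:E)%E.

End beta_distribution.

Section beta_generalized_normal.
Context {R : realType}.
Implicit Types alpha beta mu sigma s x z : R.

Definition gnormal_pdf s z : R :=
  s / (2 * Gamma s^-1) * expR (- (`|z| `^ s)).

Definition gnormal_cdf s z : R :=
  \int[lebesgue_measure]_(y in `]-oo, z]) gnormal_pdf s y.

Definition bgn_cdf alpha beta mu sigma s x : R :=
  (Beta alpha beta)^-1 *
  \int[lebesgue_measure]_(t in `[0, gnormal_cdf s ((x - mu) / sigma)])
    (t `^ (alpha - 1) * (1 - t) `^ (beta - 1)).

(* That X is a random variable is part of the property. *)
Definition BGN_distributed d (T : measurableType d) (P : probability T R)
    (X : T -> R) alpha beta mu sigma s : Prop :=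
  measurable_fun [set: T] X /\
  forall x, P [set w | X w <= x] = (bgn_cdf alpha beta mu sigma s x)%:E.

End beta_generalized_normal.

(* Main.v *)
Require Import Defs.
From mathcomp Require Import all_boot all_order all_algebra.
From mathcomp Require Import all_classical all_reals all_analysis.
From mathcomp Require Import measurable_realfun.
From mathcomp Require Import ring lra.

Set Implicit Arguments.
Unset Strict Implicit.
Unset Printing Implicit Defensive.

Import Order.TTheory GRing.Theory Num.Theory.
Import numFieldNormedType.Exports.

Local Open Scope classical_set_scope.
Local Open Scope ring_scope.

(** Write Phi for the standardized generalized normal distribution function and
G for the gamma distribution function of shape 1/s.  The substitution t = y^s
turns the gamma density into a multiple of exp(-y^s), so that
G(y^s) = 2 Phi(y) - 1 for y >= 0 ([gamma_cdf_powR]); the quantile transform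
therefore sends 2 Phi(v) - 1 to v^s ([gamma_quantile_gnormal_cdf]).  Since Phi
is symmetric, Phi(-y) = 1 - Phi(y), both branches of the definition of X say
the same thing: for 0 < U < 1, X = mu + sigma v where Phi(v) = U
([bgn_sampler_in]).  As Phi is strictly increasing, the event X <= x is
U <= Phi((x - mu) / sigma) ([bgn_sampler_le]), up to the null event that U is
not in ]0, 1[ ([beta_distributed_support]).  The beta law of U gives this event
the value at x of the BGN distribution function as its probability
([beta_distributed_itv]).

The integrals may be improper, at 0 because of the powers and at infinity
because of the domain.  Changes of variables are made on compact subintervals
of ]0, +oo[ and extended by monotone convergence.  The gamma integral at 1/s is
finite because exp(-|y|^s) <= C / (1 + y^2).  That Beta alpha beta is positive
and that the incomplete beta integrals are finite is deduced from the total
mass 1 of the law of U. *)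

(** * Powers and improper integrals *)

Section real_analysis.
Context {R : realType}.
Local Notation mu := (@lebesgue_measure R).

Lemma continuous_powR_gt0 (r x : R) : 0 < x ->
  {for x, continuous (@powR R ^~ r)}.
Proof.
move=> x0; apply: differentiable_continuous; apply/derivable1_diffP.
by apply: derivable_powR; rewrite in_itv/= x0.
Qed.

Lemma continuous_powR_derive1 (r x : R) : 0 < x ->
  {for x, continuous (@powR R ^~ r : R -> R)^`()%classic}.
Proof.
move=> x0; rewrite /prop_for /continuous_at.
rewrite powR_derive1 ?in_itv/= ?andbT//.
have h : {near x, (fun t => r * t `^ (r - 1)) =1 (@powR R ^~ r)^`()%classic}.
  near=> t; rewrite powR_derive1// in_itv/= andbT.
  by near: t; exact: lt_nbhsr.
apply: (cvg_trans (near_eq_cvg h)).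
by apply: cvgM; [exact: cvg_cst|exact: continuous_powR_gt0].
Unshelve. all: by end_near. Qed.

(** Monotone convergence along an exhaustion of ]0, b] from the left: the way a
change of variables is carried over to an integrand singular at 0. *)
Lemma cvg_integral_itv_lower (e : nat -> R) (b : R) (f : R -> R) :
  nonincreasing_seq e -> (forall n, 0 < e n) ->
  (forall t, 0 < t -> exists n, e n <= t) ->
  measurable_fun setT f -> (forall x, 0 <= f x) ->
  (\int[mu]_(t in `[e n, b]) (f t)%:E @[n --> \oo] -->
   \int[mu]_(t in `]0%R, b]) (f t)%:E)%E.
Proof.
move=> e_ni e_gt0 e_cvg mf f0.
have -> : `]0, b]%classic = \bigcup_n `[e n, b]%classic.
  apply/seteqP; split=> [t/=|t [n _]/=]; rewrite !in_itv/=.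
    move=> /andP[t0 tb]; have [n ent] := e_cvg _ t0.
    by exists n => //=; rewrite in_itv/= ent.
  by move=> /andP[ent ->]; rewrite (lt_le_trans (e_gt0 n)).
apply: ge0_nondecreasing_set_cvg_integral => //.
- move=> m n mn; apply/subsetPset; apply: subset_itvr.
  by rewrite bnd_simp e_ni.
- by move=> n; apply/measurable_EFinP; exact: measurable_funTS.
- by move=> n x _; rewrite lee_fin.
Qed.

Lemma cvg_integral_itv_upper (a : itv_bound R) (b : nat -> R) (f : R -> R) :
  nondecreasing_seq b -> (forall t, exists n, t <= b n) ->
  measurable_fun setT f -> (forall x, 0 <= f x) ->
  (\int[mu]_(t in [set` Interval a (BRight (b n))]) (f t)%:E @[n --> \oo] -->
   \int[mu]_(t in [set` Interval a +oo%O]) (f t)%:E)%E.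
Proof.
move=> b_nd b_cvg mf f0.
have -> : [set` Interval a +oo%O] =
    \bigcup_n [set` Interval a (BRight (b n))] :> set R.
  apply/seteqP; split=> [t/=|t [n _]/=].
    rewrite !itv_boundlr => /andP[a_t _]; have [n tbn] := b_cvg t.
    by exists n => //=; rewrite itv_boundlr a_t bnd_simp.
  by rewrite !itv_boundlr => /andP[-> _].
apply: ge0_nondecreasing_set_cvg_integral => //.
- move=> m n mn; apply/subsetPset; apply: subset_itvl.
  by rewrite bnd_simp b_nd.
- by move=> n; apply/measurable_EFinP; exact: measurable_funTS.
- by move=> n x _; rewrite lee_fin.
Qed.

End real_analysis.

(** * The kernel exp(-|y|^s) *)

Definition gnormal_ker {R : realType} (s y : R) : R := expR (- (`|y| `^ s)).

Section kernel.
Context {R : realType}.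
Variable s : R.
Hypothesis s_gt0 : 0 < s.
Local Notation mu := (@lebesgue_measure R).

Lemma gnormal_ker_gt0 y : 0 < gnormal_ker s y.
Proof. exact: expR_gt0. Qed.

Lemma gnormal_ker_ge0 y : 0 <= gnormal_ker s y.
Proof. exact: expR_ge0. Qed.

Lemma gnormal_ker_le1 y : gnormal_ker s y <= 1.
Proof. by rewrite /gnormal_ker expR_le1 oppr_le0 powR_ge0. Qed.

Lemma gnormal_kerN y : gnormal_ker s (- y) = gnormal_ker s y.
Proof. by rewrite /gnormal_ker normrN. Qed.

Lemma measurable_gnormal_ker (D : set R) : measurable_fun D (gnormal_ker s).
Proof.
apply: measurable_funTS; apply: measurableT_comp => //.
apply: measurableT_comp => //.
apply: (measurableT_comp (measurable_powR s)); exact: normr_measurable.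
Qed.

(** Away from 0 the kernel is a composite of continuous functions; at 0 the
power is controlled through |t| < e^(1/s). *)
Lemma continuous_gnormal_ker : continuous (gnormal_ker s).
Proof.
move=> x; rewrite /gnormal_ker.
apply: (@continuous_comp _ _ _ (fun y : R => - (`|y| `^ s)) expR); last first.
  exact: continuous_expR.
apply: continuousN.
have [->|x0] := eqVneq x 0; last first.
  apply: (@continuous_comp _ _ _ (@Num.norm R R) (@powR R ^~ s)).
    exact: norm_continuous.
  by apply: continuous_powR_gt0; rewrite normr_gt0.
apply/cvgrPdist_lt => /= e e0.
near=> t.
rewrite normr0 powR0 ?gt_eqF// sub0r normrN ger0_norm ?powR_ge0//.
have -> : e = (e `^ s^-1) `^ s by rewrite -powRrM mulVf ?gt_eqF// powRr1// ltW.
apply: gt0_ltr_powR => //; rewrite ?nnegrE ?powR_ge0//.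
near: t.
have := @norm_continuous R R^o 0.
move=> /cvgrPdist_lt /(_ (e `^ s^-1)); rewrite powR_gt0// => /(_ isT).
apply: filter_app; near=> t.
by rewrite /= normr0 sub0r normrN normr_id.
Unshelve. all: by end_near. Qed.

(** With s (n + 1) >= 2, the bound exp(x) >= 1 + x^(n+1) / (n+1)! at x = y^s
beats y^2 for y >= 1, and the kernel is at most 1 on [0, 1].  The majorant is
the derivative of arctan, whose integral is known. *)
Lemma gnormal_ker_le_oneDsqrV : exists2 C : R, 0 <= C &
  forall y : R, 0 <= y -> gnormal_ker s y <= C * (oneDsqr y)^-1.
Proof.
have [n sn] : exists n : nat, 2 <= s * n.+1%:R.
  exists (Num.truncn (2 / s)); rewrite mulrC -ler_pdivrMr//.
  by rewrite ltW// truncnS_gt.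
exists (2 * n.+1`!%:R); first by rewrite mulr_ge0.
move=> y y0; rewrite ler_pdivlMr; last first.
  by rewrite (lt_le_trans ltr01)// oneDsqr_ge1.
have f1 : 1 <= n.+1`!%:R :> R by rewrite ler1n fact_gt0.
rewrite /oneDsqr; have [y1|y1] := leP y 1.
  have := gnormal_ker_le1 y; have := gnormal_ker_ge0 y; nra.
rewrite /gnormal_ker expRN mulrC ler_pdivrMr ?expR_gt0//.
rewrite ger0_norm//.
have ge1 := expR_ge1Dxn n (powR_ge0 y s).
have : y ^+ 2 <= (y `^ s) ^+ n.+1.
  rewrite -!powR_mulrn ?powR_ge0// -powRrM.
  by apply: ler_powR => //; exact: ltW.
have f0 : 0 < n.+1`!%:R :> R by rewrite ltr0n fact_gt0.
move=> y2.
have : n.+1`!%:R + y ^+ 2 <= n.+1`!%:R * expR (y `^ s).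
  have : n.+1`!%:R * (1 + (y `^ s) ^+ n.+1 / n.+1`!%:R) <=
      n.+1`!%:R * expR (y `^ s).
    by rewrite ler_pM2l.
  by apply: le_trans; rewrite mulrDr mulr1 mulrCA divff ?gt_eqF// mulr1 lerD2l.
nra.
Qed.

Lemma integrable_gnormal_ker (D : set R) : measurable D ->
  mu.-integrable D (EFin \o gnormal_ker s).
Proof.
move=> mD; apply: (@integrableS _ _ _ _ setT) => //.
apply/integrableP; split.
  by apply/measurable_EFinP; exact: measurable_gnormal_ker.
under eq_integral do rewrite /= ger0_norm ?gnormal_ker_ge0//.
rewrite ge0_symfun_integralT; last 3 first.
- exact: gnormal_ker_ge0.
- exact: continuous_gnormal_ker.
- by move=> x; rewrite /= gnormal_kerN.
have [C C0 kC] := gnormal_ker_le_oneDsqrV.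
rewrite -set_itvcy.
have : (\int[mu]_(x in `[0%R, +oo[) (gnormal_ker s x)%:E <=
   \int[mu]_(x in `[0%R, +oo[) (C%:E * (oneDsqr x)^-1%:E))%E.
  apply: ge0_le_integral => //=.
  - by move=> x _; rewrite lee_fin gnormal_ker_ge0.
  - by apply/measurable_EFinP; exact: measurable_gnormal_ker.
  - apply: measurable_funeM; apply/measurable_EFinP/measurable_funTS.
    apply: continuous_measurable_fun; exact: continuous_oneDsqrV.
  - move=> x /=; rewrite in_itv/= andbT => x0; rewrite -EFinM lee_fin.
    exact: kC.
rewrite ge0_integralZl_EFin//; last first.
  apply/measurable_EFinP/measurable_funTS.
  apply: continuous_measurable_fun; exact: continuous_oneDsqrV.
rewrite integral0y_oneDsqr => h.
apply: lte_mul_pinfty => //.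
by apply: (le_lt_trans h); rewrite -EFinM ltry.
Qed.

Lemma measurable_scale_gnormal_ker (c : R) (D : set R) :
  measurable_fun D (fun t => c * gnormal_ker s t).
Proof. by apply: measurable_funM => //; exact: measurable_gnormal_ker. Qed.

End kernel.

(** * The substitution t = y^s *)

Section gamma_kernel.
Context {R : realType}.

Definition gamma_ker (a t : R) : R := t `^ (a - 1) * expR (- t).

Lemma gamma_ker_ge0 a t : 0 <= gamma_ker a t.
Proof. by rewrite mulr_ge0 ?powR_ge0 ?expR_ge0. Qed.

Lemma measurable_gamma_ker a (D : set R) : measurable_fun D (gamma_ker a).
Proof.
apply: measurable_funTS; apply: measurable_funM; first exact: measurable_powR.
by apply: measurableT_comp => //; exact: measurableT_comp.
Qed.

Lemma continuous_gamma_ker a x : 0 < x -> {for x, continuous (gamma_ker a)}.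
Proof.
move=> x0; apply: cvgM; first exact: continuous_powR_gt0.
by apply: (@continuous_comp _ _ _ (fun y : R => - y) expR);
  [exact: oppr_continuous|exact: continuous_expR].
Qed.

End gamma_kernel.

Section change_of_variables.
Context {R : realType}.
Variable s : R.
Hypothesis s_gt0 : 0 < s.
Local Notation mu := (@lebesgue_measure R).

(** The Jacobian identity behind the substitution: the exponents of y add up to
s (1/s - 1) + (s - 1) = 0. *)
Lemma gamma_ker_powR x : 0 < x ->
  gamma_ker s^-1 (x `^ s) * (@powR R ^~ s)^`()%classic x = s * gnormal_ker s x.
Proof.
move=> x0; rewrite powR_derive1 ?in_itv/= ?andbT// /gamma_ker /gnormal_ker.
rewrite gtr0_norm//.
have powE : (x `^ s) `^ (s^-1 - 1) * x `^ (s - 1) = 1.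
  rewrite -powRrM -powRD; last by apply/implyP => _; rewrite gt_eqF.
  have -> : s * (s^-1 - 1) + (s - 1) = 0 by field; rewrite gt_eqF.
  by rewrite powRr0.
transitivity (((x `^ s) `^ (s^-1 - 1) * x `^ (s - 1)) * (s * expR (- x `^ s))).
  ring.
by rewrite powE mul1r.
Qed.

(** Away from 0 both the substitution and the integrand are smooth, whatever the
sign of s - 1. *)
Lemma gamma_substitution_cc (x y : R) : 0 < x -> x <= y ->
  (\int[mu]_(t in `[(x `^ s)%R, (y `^ s)%R]) (gamma_ker s^-1 t)%:E =
   \int[mu]_(t in `[x, y]) (s * gnormal_ker s t)%:E)%E.
Proof.
move=> x0 xy; have y0 : 0 < y by exact: lt_le_trans xy.
rewrite (@integration_by_substitution_increasing _ (@powR R ^~ s))//.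
- apply: eq_integral => t; rewrite inE/= in_itv/= => /andP[xt _].
  by rewrite -gamma_ker_powR// (lt_le_trans x0).
- move=> u v; rewrite !in_itv/= => /andP[xu _] /andP[xv _] uv.
  by apply: gt0_ltr_powR => //; rewrite nnegrE ltW// (lt_le_trans x0).
- move=> u; rewrite in_itv/= => /andP[xu _].
  by apply: continuous_powR_derive1; exact: lt_trans xu.
- apply/cvg_ex; eexists; apply: cvg_at_right_filter.
  exact: continuous_powR_derive1.
- apply/cvg_ex; eexists; apply: cvg_at_left_filter.
  exact: continuous_powR_derive1.
- split.
  + move=> u; rewrite in_itv/= => /andP[xu _].
    by apply: derivable_powR; rewrite in_itv/= andbT (lt_trans x0).
  + by apply: cvg_at_right_filter; exact: continuous_powR_gt0.
  + by apply: cvg_at_left_filter; exact: continuous_powR_gt0.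
- apply: continuous_in_subspaceT => u; rewrite inE/= in_itv/= => /andP[xu _].
  by apply: continuous_gamma_ker; rewrite (lt_le_trans _ xu)// powR_gt0.
Qed.

Lemma gamma_substitution_oc (z : R) : 0 < z ->
  (\int[mu]_(t in `]0%R, (z `^ s)%R]) (gamma_ker s^-1 t)%:E =
   \int[mu]_(t in `]0%R, z]) (s * gnormal_ker s t)%:E)%E.
Proof.
move=> z0; pose e n := z / n.+1%:R.
have e_gt0 n : 0 < e n by rewrite divr_gt0.
have e_ni : nonincreasing_seq e.
  by move=> m n mn; rewrite ler_pM2l// lef_pV2 ?posrE// ler_nat.
have e_cvg t : 0 < t -> exists n, e n <= t.
  move=> t0; exists (Num.truncn (z / t)).
  by rewrite ler_pdivrMr// mulrC -ler_pdivrMr// ltW// truncnS_gt.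
have cvg_ker : (\int[mu]_(t in `[e n, z]) (s * gnormal_ker s t)%:E
    @[n --> \oo] --> \int[mu]_(t in `]0%R, z]) (s * gnormal_ker s t)%:E)%E.
  apply: cvg_integral_itv_lower => //.
    exact: measurable_scale_gnormal_ker.
  by move=> x; rewrite mulr_ge0 ?gnormal_ker_ge0// ltW.
suff cvg_gamma : (\int[mu]_(t in `[(e n `^ s)%R, (z `^ s)%R])
      (gamma_ker s^-1 t)%:E @[n --> \oo] -->
    \int[mu]_(t in `]0%R, (z `^ s)%R]) (gamma_ker s^-1 t)%:E)%E.
  have eq_cc n : (\int[mu]_(t in `[(e n `^ s)%R, (z `^ s)%R])
      (gamma_ker s^-1 t)%:E =
      \int[mu]_(t in `[e n, z]) (s * gnormal_ker s t)%:E)%E.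
    by rewrite gamma_substitution_cc// ler_pdivrMr// ler_pMr// ler1n.
  rewrite (funext eq_cc) in cvg_gamma.
  exact: (cvg_unique _ cvg_gamma cvg_ker).
apply: (@cvg_integral_itv_lower _ (fun n => e n `^ s)).
- move=> m n mn; apply: ge0_ler_powR; [exact: ltW| | |exact: e_ni];
    by rewrite nnegrE ltW.
- by move=> n; rewrite powR_gt0.
- move=> t t0; have [n ent] := e_cvg (t `^ s^-1) (powR_gt0 _ t0).
  exists n; have -> : t = (t `^ s^-1) `^ s.
    by rewrite -powRrM mulVf ?gt_eqF// powRr1// ltW.
  apply: ge0_ler_powR => //; first exact: ltW.
    by rewrite nnegrE ltW.
  by rewrite nnegrE powR_ge0.
- exact: measurable_gamma_ker.
- exact: gamma_ker_ge0.
Qed.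

Lemma gamma_substitution_oy :
  (\int[mu]_(t in `]0%R, +oo[) (gamma_ker s^-1 t)%:E =
   \int[mu]_(t in `]0%R, +oo[) (s * gnormal_ker s t)%:E)%E.
Proof.
pose b n : R := n.+1%:R.
have b_nd : nondecreasing_seq b by move=> m n mn; rewrite ler_nat.
have b_cvg t : exists n, t <= b n.
  by exists (Num.truncn t); rewrite ltW// truncnS_gt.
have cvg_ker : (\int[mu]_(t in `]0%R, b n]) (s * gnormal_ker s t)%:E
    @[n --> \oo] --> \int[mu]_(t in `]0%R, +oo[) (s * gnormal_ker s t)%:E)%E.
  apply: cvg_integral_itv_upper => //.
    exact: measurable_scale_gnormal_ker.
  by move=> x; rewrite mulr_ge0 ?gnormal_ker_ge0// ltW.
suff cvg_gamma : (\int[mu]_(t in `]0%R, (b n `^ s)%R])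
      (gamma_ker s^-1 t)%:E @[n --> \oo] -->
    \int[mu]_(t in `]0%R, +oo[) (gamma_ker s^-1 t)%:E)%E.
  have eq_oc n : (\int[mu]_(t in `]0%R, (b n `^ s)%R])
      (gamma_ker s^-1 t)%:E =
      \int[mu]_(t in `]0%R, b n]) (s * gnormal_ker s t)%:E)%E.
    by rewrite gamma_substitution_oc.
  rewrite (funext eq_oc) in cvg_gamma.
  exact: (cvg_unique _ cvg_gamma cvg_ker).
apply: (@cvg_integral_itv_upper _ _ (fun n => b n `^ s)).
- move=> m n mn; apply: ge0_ler_powR; [exact: ltW| | |exact: b_nd];
    by rewrite nnegrE ltW.
- move=> t; have [n btn] := b_cvg (`|t| `^ s^-1).
  exists n; apply: le_trans (ler_norm t) _.
  have -> : `|t| = (`|t| `^ s^-1) `^ s.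
    by rewrite -powRrM mulVf ?gt_eqF// powRr1.
  apply: ge0_ler_powR => //; first exact: ltW.
    by rewrite nnegrE powR_ge0.
  by rewrite nnegrE ltW.
- exact: measurable_gamma_ker.
- exact: gamma_ker_ge0.
Qed.

End change_of_variables.

(** * The generalized normal distribution function *)

Section gnormal_distribution.
Context {R : realType}.
Variable s : R.
Hypothesis s_gt0 : 0 < s.
Local Notation mu := (@lebesgue_measure R).

(** On ]x, y] the kernel is at least its value at the endpoint of largest
modulus. *)
Lemma Rintegral_gnormal_ker_gt0 x y : x < y ->
  0 < \int[mu]_(t in `]x, y]) gnormal_ker s t.
Proof.
move=> xy; pose m := gnormal_ker s (Num.max `|x| `|y|).
have : \int[mu]_(t in `]x, y]) m <= \int[mu]_(t in `]x, y]) gnormal_ker s t.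
  apply: le_Rintegral => //.
  - apply: measurable_bounded_integrable => //.
    + by rewrite /= lebesgue_measure_itv/= lte_fin xy ltry.
    + exact: bounded_cst.
  - exact: integrable_gnormal_ker.
  - move=> t /=; rewrite in_itv/= => /andP[xt ty].
    rewrite ler_expR lerN2; apply: ge0_ler_powR => //; first exact: ltW.
    apply: le_trans (ler_norm _); rewrite le_max.
    have [t0|t0] := leP 0 t.
      by rewrite (ger0_norm t0) (le_trans ty (ler_norm y)) orbT.
    by rewrite (ltr0_norm t0) -(normrN x) (le_trans _ (ler_norm _))// lerN2 ltW.
apply: lt_le_trans; rewrite Rintegral_cst//= lebesgue_measure_itv/= lte_fin xy.
by rewrite /= mulr_gt0 ?gnormal_ker_gt0// subr_gt0.
Qed.

Lemma Rintegral0y_gnormal_ker_gt0 :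
  0 < \int[mu]_(t in `]0, +oo[) gnormal_ker s t.
Proof.
have := @Rintegral_itvB R (gnormal_ker s) (BRight 0) +oo%O 1.
move=> /(_ (integrable_gnormal_ker s_gt0 (measurable_itv _)))/=.
rewrite bnd_simp => /(_ ler01 isT) /eqP; rewrite subr_eq => /eqP ->.
rewrite ltr_wpDl ?Rintegral_gnormal_ker_gt0// Rintegral_ge0// => x _.
exact: gnormal_ker_ge0.
Qed.

(** The classical formula behind the normalizing constant of the generalized
normal law. *)
Lemma GammaV_gnormal_ker :
  Gamma s^-1 = s * \int[mu]_(t in `]0, +oo[) gnormal_ker s t.
Proof.
rewrite /Gamma /Rintegral -RintegralZl//; last exact: integrable_gnormal_ker.
by rewrite /Rintegral -gamma_substitution_oy.
Qed.

Lemma GammaV_gt0 : 0 < Gamma s^-1.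
Proof.
by rewrite GammaV_gnormal_ker mulr_gt0// Rintegral0y_gnormal_ker_gt0.
Qed.

Lemma gnormal_pdfE z : gnormal_pdf s z = s / (2 * Gamma s^-1) * gnormal_ker s z.
Proof. by []. Qed.

Let c_gt0 : 0 < s / (2 * Gamma s^-1).
Proof. by rewrite divr_gt0// mulr_gt0// GammaV_gt0. Qed.

Lemma gnormal_pdf_ge0 z : 0 <= gnormal_pdf s z.
Proof. by rewrite gnormal_pdfE mulr_ge0 ?gnormal_ker_ge0// ltW. Qed.

Lemma measurable_gnormal_pdf (D : set R) : measurable_fun D (gnormal_pdf s).
Proof. exact: measurable_scale_gnormal_ker. Qed.

Lemma integrable_gnormal_pdf (D : set R) : measurable D ->
  mu.-integrable D (EFin \o gnormal_pdf s).
Proof.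
move=> mD.
rewrite (_ : _ \o _ = fun x => ((s / (2 * Gamma s^-1))%:E *
  (EFin \o gnormal_ker s) x)%E)//.
by apply: integrableZl => //; exact: integrable_gnormal_ker.
Qed.

Lemma Rintegral_gnormal_pdfE (D : set R) : measurable D ->
  \int[mu]_(t in D) gnormal_pdf s t =
  s / (2 * Gamma s^-1) * \int[mu]_(t in D) gnormal_ker s t.
Proof. by move=> mD; rewrite -RintegralZl//; exact: integrable_gnormal_ker. Qed.

Lemma gnormal_cdfB x y : x <= y ->
  gnormal_cdf s y - gnormal_cdf s x = \int[mu]_(t in `]x, y]) gnormal_pdf s t.
Proof.
move=> xy; rewrite /gnormal_cdf Rintegral_itvB//.
exact: integrable_gnormal_pdf.
Qed.

Lemma gnormal_cdf_lt : {homo gnormal_cdf s : x y / x < y}.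
Proof.
move=> x y xy; rewrite -subr_gt0 gnormal_cdfB ?ltW// Rintegral_gnormal_pdfE//.
by rewrite mulr_gt0// Rintegral_gnormal_ker_gt0.
Qed.

(** The density is bounded by its value at 0. *)
Lemma gnormal_cdf_lipschitz x y : x <= y ->
  gnormal_cdf s y - gnormal_cdf s x <= s / (2 * Gamma s^-1) * (y - x).
Proof.
rewrite le_eqVlt => /predU1P[->|xy]; first by rewrite !subrr mulr0.
rewrite (gnormal_cdfB (ltW xy)) Rintegral_gnormal_pdfE// ler_pM2l//.
have -> : y - x = \int[mu]_(t in `]x, y]) (1 : R).
  by rewrite Rintegral_cst//= lebesgue_measure_itv/= lte_fin xy mul1r.
apply: le_Rintegral => //.
- exact: integrable_gnormal_ker.
- apply: measurable_bounded_integrable => //.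
  + by rewrite /= lebesgue_measure_itv/= lte_fin xy ltry.
  + exact: bounded_cst.
- by move=> t _; exact: gnormal_ker_le1.
Qed.

Lemma gnormal_cdf_continuous : continuous (gnormal_cdf s).
Proof.
move=> x; apply/cvgrPdist_le => /= e e0; near=> y.
have lip u v : u <= v ->
    `|gnormal_cdf s v - gnormal_cdf s u| <= s / (2 * Gamma s^-1) * `|v - u|.
  move=> uv; rewrite ger0_norm ?ger0_norm ?subr_ge0//.
    exact: gnormal_cdf_lipschitz.
  by move: uv; rewrite le_eqVlt => /predU1P[->//|/gnormal_cdf_lt/ltW].
suff h : `|gnormal_cdf s x - gnormal_cdf s y| <=
    s / (2 * Gamma s^-1) * `|x - y|.
  apply: (le_trans h); rewrite mulrC -ler_pdivlMr//.
  near: y; have := @cvgr_dist_le _ _ _ (nbhs x) _ id x (@cvg_id _ _); apply.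
  by rewrite divr_gt0.
have [xy|yx] := leP x y; last exact/lip/ltW.
by rewrite distrC [X in _ <= _ * X]distrC; exact: lip.
Unshelve. all: by end_near. Qed.

Lemma integralT_gnormal_pdf :
  (\int[mu]_(t in `]-oo, +oo[) (gnormal_pdf s t)%:E = 1)%E.
Proof.
have mker (D : set R) : measurable D ->
    (\int[mu]_(t in D) (gnormal_ker s t)%:E =
    (\int[mu]_(t in D) gnormal_ker s t)%:E)%E.
  move=> mD; rewrite /Rintegral fineK//.
  by apply: integrable_fin_num => //; exact: integrable_gnormal_ker.
under eq_integral do rewrite gnormal_pdfE EFinM.
rewrite ge0_integralZl_EFin//; last 3 first.
- by move=> x _; rewrite lee_fin gnormal_ker_ge0.
- by apply/measurable_EFinP; exact: measurable_gnormal_ker.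
- exact: ltW.
rewrite set_itvNyy ge0_symfun_integralT; last 3 first.
- exact: gnormal_ker_ge0.
- exact: continuous_gnormal_ker.
- by move=> x; rewrite /= gnormal_kerN.
rewrite -set_itvcy -integral_itv_obnd_cbnd; last first.
  by apply/measurable_EFinP; exact: measurable_gnormal_ker.
rewrite mker// -!EFinM; congr EFin.
have J0 := Rintegral0y_gnormal_ker_gt0; rewrite GammaV_gnormal_ker.
by field; rewrite !gt_eqF.
Qed.

Lemma gnormal_cdfN y : gnormal_cdf s (- y) = 1 - gnormal_cdf s y.
Proof.
have -> : 1 = \int[mu]_(t in `]-oo, +oo[) gnormal_pdf s t.
  by rewrite /Rintegral integralT_gnormal_pdf.
rewrite /gnormal_cdf Rintegral_itvB//; last exact: integrable_gnormal_pdf.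
rewrite Rintegral_itv_obnd_cbnd; last exact: integrable_gnormal_pdf.
rewrite /Rintegral ge0_integration_by_substitutionNy.
- have -> // : gnormal_pdf s \o -%R = gnormal_pdf s.
  by apply/funext => t; rewrite /= !gnormal_pdfE gnormal_kerN.
- apply: continuous_subspaceT => x.
  by apply: cvgM; [exact: cvg_cst|exact: continuous_gnormal_ker].
- by move=> x _; exact: gnormal_pdf_ge0.
Qed.

Lemma gnormal_cdf0 : gnormal_cdf s 0 = 2^-1.
Proof. by have := gnormal_cdfN 0; rewrite oppr0; lra. Qed.

Lemma gnormal_cdf_ge0 y : 0 <= gnormal_cdf s y.
Proof. by apply: Rintegral_ge0 => x _; exact: gnormal_pdf_ge0. Qed.

Lemma gnormal_cdf_lt1 y : gnormal_cdf s y < 1.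
Proof.
have yy1 : y < y + 1 by lra.
apply: lt_le_trans (gnormal_cdf_lt yy1) _.
by have := gnormal_cdf_ge0 (- (y + 1)); rewrite gnormal_cdfN; lra.
Qed.

Lemma gnormal_cdf_gt0 y : 0 < gnormal_cdf s y.
Proof. by have := gnormal_cdf_lt1 (- y); rewrite gnormal_cdfN; lra. Qed.

(** The integrals of the density over ]-oo, n] increase to its total mass 1. *)
Lemma gnormal_cdf_cofinal u : u < 1 -> exists2 N, 0 <= N & u <= gnormal_cdf s N.
Proof.
move=> u1; pose b n : R := n%:R.
have b_nd : nondecreasing_seq b by move=> m n mn; rewrite ler_nat.
have b_cvg t : exists n, t <= b n.
  by exists (Num.truncn t).+1; rewrite ltW// truncnS_gt.
have := cvg_integral_itv_upper (a := -oo%O) b_nd b_cvg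
  (@measurable_gnormal_pdf setT) gnormal_pdf_ge0.
rewrite integralT_gnormal_pdf => /fine_cvg /cvgr_ge /(_ _ u1) [n _ /(_ n)].
by move=> /(_ (leqnn _)) h; exists (b n).
Qed.

(** If Z has the generalized normal law then |Z|^s has the gamma law of shape
1/s; this is P(|Z| <= y) = Phi(y) - Phi(-y) after that change of variable. *)
Lemma gamma_cdf_powR y : 0 <= y ->
  gamma_cdf s^-1 (y `^ s) = 2 * gnormal_cdf s y - 1.
Proof.
rewrite le_eqVlt => /predU1P[<-|y0].
  rewrite powR0 ?gt_eqF// /gamma_cdf set_itv1 Rintegral_set1 mul0r gnormal_cdf0.
  lra.
have -> : 2 * gnormal_cdf s y - 1 =
    2 * (gnormal_cdf s y - gnormal_cdf s 0) by rewrite gnormal_cdf0; lra.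
rewrite gnormal_cdfB ?ltW// Rintegral_gnormal_pdfE//.
rewrite /gamma_cdf.
have -> : \int[mu]_(t in `[0, y `^ s]) (t `^ (s^-1 - 1) * expR (- t)) =
    s * \int[mu]_(t in `]0, y]) gnormal_ker s t.
  rewrite -[RHS]RintegralZl//; last exact: integrable_gnormal_ker.
  rewrite /Rintegral -gamma_substitution_oc// integral_itv_obnd_cbnd//.
  by apply/measurable_EFinP; exact: measurable_gamma_ker.
have G0 := GammaV_gt0.
by field; rewrite gt_eqF.
Qed.

End gnormal_distribution.

(** * The quantile transform *)

Section quantile.
Context {R : realType}.
Variable s : R.
Hypothesis s_gt0 : 0 < s.

Let powRVK (x : R) : 0 <= x -> (x `^ s^-1) `^ s = x.
Proof. by move=> x0; rewrite -powRrM mulVf ?gt_eqF// powRr1. Qed.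

Let powRKV (x : R) : 0 <= x -> (x `^ s) `^ s^-1 = x.
Proof. by move=> x0; rewrite -powRrM mulfV ?gt_eqF// powRr1. Qed.

(** The gamma distribution function stays below 1, so the defining set is empty
and its infimum is 0 by convention. *)
Lemma gamma_quantile_ge1 p : 1 <= p -> gamma_quantile s^-1 p = 0.
Proof.
move=> p1; rewrite /gamma_quantile (_ : [set x | _] = set0) ?inf0//.
apply/seteqP; split=> x //= -[x0].
rewrite -(powRVK x0) gamma_cdf_powR ?powR_ge0//.
by have := gnormal_cdf_lt1 s_gt0 (x `^ s^-1); lra.
Qed.

(** By strict monotonicity the set defining the quantile is the half-line
[v^s, +oo[. *)
Lemma gamma_quantile_gnormal_cdf v : 0 <= v ->
  gamma_quantile s^-1 (2 * gnormal_cdf s v - 1) = v `^ s.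
Proof.
move=> v0; rewrite /gamma_quantile.
rewrite (_ : [set x | _] = `[v `^ s, +oo[%classic); first by rewrite inf_itv.
have mono := le_mono (gnormal_cdf_lt s_gt0).
have cdf_le x : 0 <= x -> (2 * gnormal_cdf s v - 1 <= gamma_cdf s^-1 x) =
    (v `^ s <= x).
  move=> x0; rewrite -[in LHS](powRVK x0) gamma_cdf_powR ?powR_ge0//.
  rewrite lerD2r ler_pM2l// mono; apply/idP/idP => [vx|vx].
    rewrite -(powRVK x0); apply: ge0_ler_powR => //; first exact: ltW.
    by rewrite nnegrE powR_ge0.
  rewrite -(powRKV v0); apply: ge0_ler_powR => //; rewrite ?nnegrE ?powR_ge0//.
  by rewrite invr_ge0 ltW.
apply/seteqP; split=> x /=; rewrite in_itv/= andbT.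
  by move=> [x0]; rewrite cdf_le.
move=> vx; have x0 : 0 <= x by apply: le_trans vx; exact: powR_ge0.
by rewrite cdf_le.
Qed.

Lemma gnormal_cdf_surj u : 2^-1 <= u < 1 ->
  exists2 v, 0 <= v & gnormal_cdf s v = u.
Proof.
move=> /andP[u2 u1]; have [N N0 uN] := gnormal_cdf_cofinal s_gt0 u1.
have cont : {within `[0, N], continuous gnormal_cdf s}.
  by apply: continuous_subspaceT; exact: gnormal_cdf_continuous.
have h0 := gnormal_cdf0 s_gt0.
have [|v] := @IVT _ _ _ _ u N0 cont.
  by rewrite ge_min le_max uN h0 u2 orbT.
by rewrite in_itv/= => /andP[v0 _] vu; exists v.
Qed.

Definition bgn_sampler (mu sigma u : R) : R :=
  if u <= 2^-1 then mu - sigma * (gamma_quantile s^-1 (1 - 2 * u)) `^ s^-1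
  else mu + sigma * (gamma_quantile s^-1 (2 * u - 1)) `^ s^-1.

(** Here 1 - 2u or 2u - 1 is at least 1, where the quantile is 0. *)
Lemma bgn_sampler_out (mu sigma u : R) : ~~ (0 < u < 1) ->
  bgn_sampler mu sigma u = mu.
Proof.
have pow0 : 0 `^ s^-1 = 0 :> R by rewrite powR0// invr_eq0 gt_eqF.
rewrite /bgn_sampler => u01; case: ifPn => u2.
- rewrite gamma_quantile_ge1 ?pow0 ?mulr0 ?subr0//; lra.
- rewrite gamma_quantile_ge1 ?pow0 ?mulr0 ?addr0//; lra.
Qed.

(** In the lower branch, u <= 1/2, the upper one is applied to 1 - u: if v has
Phi(v) = 1 - u then Phi(-v) = u by symmetry. *)
Lemma bgn_sampler_in (mu sigma u : R) : 0 < u < 1 ->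
  exists2 v, gnormal_cdf s v = u & bgn_sampler mu sigma u = mu + sigma * v.
Proof.
move=> u01; rewrite /bgn_sampler; case: ifPn => u2.
- have [|v v0 vu] := @gnormal_cdf_surj (1 - u); first lra.
  exists (- v); first by rewrite gnormal_cdfN// vu; lra.
  have -> : 1 - 2 * u = 2 * gnormal_cdf s v - 1 by lra.
  by rewrite gamma_quantile_gnormal_cdf// powRKV// mulrN.
- have [|v v0 vu] := @gnormal_cdf_surj u; first lra.
  by exists v => //; rewrite -vu gamma_quantile_gnormal_cdf// powRKV.
Qed.

Lemma bgn_sampler_le (mu sigma x u : R) : 0 < sigma ->
  (bgn_sampler mu sigma u <= x) =
  if 0 < u < 1 then u <= gnormal_cdf s ((x - mu) / sigma) else mu <= x.
Proof.
move=> sigma0; case: ifPn => [u01|]; last by move=> /bgn_sampler_out ->.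
have [v <- ->] := bgn_sampler_in mu sigma u01.
rewrite (le_mono (gnormal_cdf_lt s_gt0)) ler_pdivlMr// mulrC lerBrDl.
by [].
Qed.

Lemma measurable_bgn_sampler (mu sigma : R) : 0 < sigma ->
  measurable_fun [set: R] (bgn_sampler mu sigma).
Proof.
move=> sigma0.
apply: (measurability (@RGenOInfty.G R)) => [|/= _ [_] [x] -> <-].
  exact: RGenOInfty.measurableE.
rewrite setTI (_ : _ @^-1` _ =
    `]0, 1[%classic `&` `]gnormal_cdf s ((x - mu) / sigma), +oo[%classic `|`
    ~` `]0, 1[%classic `&` (if x < mu then setT else set0)).
  apply: measurableU; apply: measurableI => //; first exact: measurableC.
  by case: ifP.
have gtE u : (x < bgn_sampler mu sigma u) =
    if 0 < u < 1 then gnormal_cdf s ((x - mu) / sigma) < u else x < mu.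
  by rewrite ltNge bgn_sampler_le//; case: ifP => _; rewrite -ltNge.
apply/seteqP; split=> u /=; rewrite !in_itv/= !andbT gtE.
- by case: ifPn => u01 h; [left|right; rewrite h; split => //; exact/negP].
- by move=> [[-> //]|[/negP/negbTE ->]]; case: ifPn.
Qed.

End quantile.

(** * The beta distribution *)

Section beta.
Context {R : realType} {d : measure_display} {T : measurableType d}.
Context {P : probability T R}.
Variables (U : {RV P >-> R}) (alpha beta : R).
Hypothesis U_beta : beta_distributed U alpha beta.
Local Notation mu := (@lebesgue_measure R).
Let f (t : R) := t `^ (alpha - 1) * (1 - t) `^ (beta - 1).

Let f_ge0 t : 0 <= f t.
Proof. by rewrite mulr_ge0 ?powR_ge0. Qed.

Let mf (D : set R) : measurable_fun D f.
Proof.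
apply: measurable_funTS; apply: measurable_funM; first exact: measurable_powR.
apply: (measurableT_comp (measurable_powR _)) => //.
exact: measurable_funB.
Qed.

Lemma measurable_RV_preimage (A : set R) : measurable A ->
  measurable (U @^-1` A).
Proof. by move=> mA; rewrite -[_ @^-1` _]setTI; exact: measurable_funP. Qed.

(** A gamma integral is nonnegative, so Beta is too; if it vanished, the beta
density would be identically 0 (division by 0 gives 0) and could not have total
mass 1. *)
Lemma beta_distributed_Beta_gt0 : 0 < Beta alpha beta.
Proof.
have Gamma_ge0 a : 0 <= Gamma a :> R.
  by apply: Rintegral_ge0 => t _; exact: gamma_ker_ge0.
rewrite lt_neqAle [Beta _ _ in X in _ && X]/Beta divr_ge0 ?mulr_ge0// andbT.
apply/eqP => B0.
have := U_beta measurableT; rewrite probability_setT.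
rewrite integral0_eq; first by move=> /eqP; rewrite onee_eq0.
by move=> t _; rewrite /beta_density -B0 invr0 mulr0; case: ifP.
Qed.

Lemma beta_distributed_preimage (A : set R) : measurable A ->
  P (U @^-1` A) = (\int[mu]_(t in A) (beta_density alpha beta t)%:E)%E.
Proof. exact: U_beta. Qed.

(** The density vanishes off [0, 1], and the end points have measure 0. *)
Lemma beta_distributed_support : P (U @^-1` (~` `]0, 1[%classic)) = 0%E.
Proof.
have density0 t : ~~ (0 <= t <= 1) -> (beta_density alpha beta t)%:E = 0%E.
  by rewrite /beta_density => /negbTE ->.
have out0 (D : set R) : (forall t, D t -> ~~ (0 <= t <= 1)) ->
    measurable_fun D (fun t => (beta_density alpha beta t)%:E) /\
    (\int[mu]_(t in D) (beta_density alpha beta t)%:E)%E = 0%E.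
  move=> D01; split; last by apply: integral0_eq => t /D01/density0.
  apply: (eq_measurable_fun (cst 0%E)) => [t|]; last exact: measurable_cst.
  by rewrite inE => /D01/density0.
rewrite (_ : ~` _ = `]-oo, 0]%classic `|` `[1, +oo[%classic); last first.
  rewrite -(setCitv `]0, 1[).
  by apply/seteqP; split=> t.
have [m0 i0] : measurable_fun `]-oo, (0 : R)[
      (fun t => (beta_density alpha beta t)%:E) /\
    (\int[mu]_(t in `]-oo, 0%R[) (beta_density alpha beta t)%:E)%E = 0%E.
  by apply: out0 => t /=; rewrite in_itv/= => t0; lra.
have [m1 i1] : measurable_fun `](1 : R), +oo[
      (fun t => (beta_density alpha beta t)%:E) /\
    (\int[mu]_(t in `]1%R, +oo[) (beta_density alpha beta t)%:E)%E = 0%E.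
  by apply: out0 => t /=; rewrite in_itv/= => t0; lra.
rewrite preimage_setU measureU0.
- apply: etrans (beta_distributed_preimage _) _ => //.
  by rewrite -integral_itv_bndo_bndc.
- exact: measurable_RV_preimage.
- exact: measurable_RV_preimage.
- apply: etrans (beta_distributed_preimage _) _ => //.
  by rewrite -integral_itv_obnd_cbnd.
Qed.

(** Finiteness of the incomplete integral is read off from the probability, to
which it is proportional with the nonzero factor Beta. *)
Lemma beta_distributed_itv z : 0 < z < 1 ->
  P (U @^-1` `]0, z]%classic) =
  ((Beta alpha beta)^-1 * \int[mu]_(t in `[0, z]) f t)%:E.
Proof.
move=> z01; have B0 := beta_distributed_Beta_gt0.
have PE : P (U @^-1` `]0, z]%classic) =
    ((Beta alpha beta)^-1%:E * \int[mu]_(t in `]0%R, z]) (f t)%:E)%E.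
  rewrite beta_distributed_preimage// -ge0_integralZl_EFin ?invr_ge0 ?ltW//.
  - apply: eq_integral => t; rewrite inE/= in_itv/= => /andP[t0 tz].
    rewrite /beta_density ifT; last by lra.
    by rewrite -EFinM mulrC.
  - by move=> t _; rewrite lee_fin.
  - by apply/measurable_EFinP; exact: mf.
have int_fin : (\int[mu]_(t in `]0%R, z]) (f t)%:E)%E \is a fin_num.
  have -> : (\int[mu]_(t in `]0%R, z]) (f t)%:E =
      (Beta alpha beta)%:E * P (U @^-1` `]0%R, z]%classic))%E.
    by rewrite PE muleA -EFinM mulfV ?gt_eqF// mul1e.
  by rewrite fin_numM// fin_num_measure//; exact: measurable_RV_preimage.
rewrite PE /Rintegral -integral_itv_obnd_cbnd; last first.
  by apply/measurable_EFinP; exact: mf.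
by rewrite EFinM fineK.
Qed.

End beta.

Unset Implicit Arguments.

Theorem mainTheorem2 (R : realType) (d : measure_display)
    (T : measurableType d) (P : probability T R)
    (alpha beta mu sigma s : R)
    (alpha_gt0 : 0 < alpha) (beta_gt0 : 0 < beta)
    (sigma_gt0 : 0 < sigma) (s_gt0 : 0 < s)
    (U : {RV P >-> R}) (U_beta : beta_distributed U alpha beta)
    (X : T -> R)
    (X_def : forall w : T, X w =
       if U w <= 2^-1
       then mu - sigma * (gamma_quantile s^-1 (1 - 2 * U w)) `^ s^-1
       else mu + sigma * (gamma_quantile s^-1 (2 * U w - 1)) `^ s^-1) :
  BGN_distributed P X alpha beta mu sigma s.
Proof.
have XE : X = bgn_sampler s mu sigma \o U by apply/funext => w; rewrite X_def.
split=> [|x].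
  rewrite XE; apply: measurableT_comp => //.
  exact: measurable_bgn_sampler.
set z := gnormal_cdf s ((x - mu) / sigma).
have z01 : 0 < z < 1 by rewrite gnormal_cdf_gt0// gnormal_cdf_lt1.
rewrite /bgn_cdf -(beta_distributed_itv U_beta z01).
have out0 (A : set R) : measurable A ->
    P (U @^-1` (~` `]0, 1[%classic `&` A)) = 0%E.
  move=> mA; apply: (subset_measure0 _ _ _ (beta_distributed_support U_beta)).
  - apply: measurable_RV_preimage; apply: measurableI => //.
    exact: measurableC.
  - by apply: measurable_RV_preimage; exact: measurableC.
  - by apply: preimage_subset; exact: subIsetl.
(* The part of the event on which U is outside ]0, 1[, where X = mu. *)
pose A : set R := if mu <= x then setT else set0.
have mA : measurable A by rewrite /A; case: ifP.
rewrite -[RHS](measureU0 _ _ (out0 A mA)).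
- congr (P _); rewrite -preimage_setU XE.
  apply/seteqP; split=> w /=; rewrite bgn_sampler_le// !in_itv/= -/z.
  + case: ifPn => [/andP[u0 _] uz|/negP u01 mux]; first by left; rewrite u0.
    by right; split => //; rewrite /A mux.
  + move=> [/andP[u0 uz]|[/negP/negbTE -> ]].
      by rewrite u0 (le_lt_trans uz)//; case/andP: z01.
    by rewrite /A; case: ifP.
- exact: measurable_RV_preimage.
- apply: measurable_RV_preimage; apply: measurableI => //.
  exact: measurableC.
Qed.
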